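(* Let $q=(u,v,p)$ be a state with constant pressure $p$ (all nodal values equal) and with velocities $u,v$ such that $U_{\alpha;\beta}+V_{\alpha;\beta}=f_\alpha+g_\beta$ for some arrays $f=(f_\alpha)$, $g=(g_\beta)$, or equivalently such that $\Phi^E_{i,s;j,r}=0$ for all cells $E=E_{ij}$ and all $s,r\in\{0,\dots,K\}$. Then $q$ is a steady equilibrium of the GFq-based SUPG method, i.e. $(\mathcal E_{\text{C-GFq}}+\mathcal E_{\text{SU-GFq}})\,q=0$.
   Context: Grid and spaces: $K\ge1$; $\Omega^x=\bigcup_{i=0}^{N_x-1}E^x_i$ with $E_i^x=[x_i,x_{i+1}]$ of equal length $\Delta x$, $\Omega^y=\bigcup_{j=0}^{N_y-1}E^y_j$ with $E_j^y=[y_j,y_{j+1}]$ of equal length $\Delta y$; $E_{ij}=E^x_i\times E^y_j$, $h=\min\{\Delta x,\Delta y\}$. With the Gauss–Lobatto points $0=\xi_0<\dots<\xi_K=1$ of $[0,1]$, set $x_{i,s}=x_i+\xi_s\Delta x$, $y_{j,r}=y_j+\xi_r\Delta y$ (so $x_{i,K}=x_{i+1,0}$), numbered globally as $x_\alpha=x_{i,s}$, $\alpha=iK+s$, $0\le\alpha\le N_xK$, and similarly $y_\beta$. A grid function $w=(w_{\alpha;\beta})$ is identified with $w_h=\sum w_{\alpha;\beta}\varphi^x_\alpha(x)\varphi^y_\beta(y)$, where $\varphi^x_\alpha$ is continuous, of degree $\le K$ on each cell, with $\varphi^x_\alpha(x_{\alpha'})=\delta_{\alpha\alpha'}$ (same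 in $y$). Matrices (no boundary conditions are imposed): $(M_x)_{\alpha\beta}=\int\varphi^x_\alpha\varphi^x_\beta$, $(D_x)_{\alpha\beta}=\int\varphi^x_\alpha\partial_x\varphi^x_\beta$, $(D^x)_{\alpha\beta}=\int\partial_x\varphi^x_\alpha\,\varphi^x_\beta$, $(D^x_x)_{\alpha\beta}=\int\partial_x\varphi^x_\alpha\partial_x\varphi^x_\beta$, all over $\Omega^x$ and evaluated with Gauss–Lobatto quadrature at the nodes; same in $y$. Integrator: $(I_xw)_\alpha=\int_{x_0}^{x_\alpha}w_h\,dx$ with $w_h=\sum_{\alpha'} w_{\alpha'}\varphi^x_{\alpha'}$, similarly $I_y$. Tensor products act by $((A\otimes B)q)_{\alpha;\beta}=\sum_{\alpha',\beta'}A_{\alpha\alpha'}B_{\beta\beta'}q_{\alpha';\beta'}$. Set $U=(\mathrm{Id}\otimes I_y)u$, $V=(I_x\otimes\mathrm{Id})v$, and for $E=E_{ij}$ $$\Phi^E_{i,s;j,r}=\int_{y_{j,0}}^{y_{j,r}}\big(u_h(x_{i,s},y)-u_h(x_{i,0},y)\big)dy+\int_{x_{i,0}}^{x_{i,s}}\big(v_h(x,y_{j,r})-v_h(x,y_{j,0})\big)dx.$$ The SUPG-GFq semi-discretization of linear acoustics $\partial_tu+\partial_xp=0$, $\partial_tv+\partial_yp=0$, $\partial_tp+\partial_xu+\partial_yv=0$ has the form $\mathcal A\,\frac{d}{dt}q+(\mathcal E_{\text{C-GFq}}+\mathcal E_{\text{SU-GFq}})q=0$, where $\mathcal A$ is a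 fixed matrix and, with a constant stabilization parameter $\alpha$, $$\mathcal E_{\text{C-GFq}}=\begin{pmatrix} 0&0&D_x\otimes M_y \\ 0&0&M_x\otimes D_y \\ {D_x}\otimes(D_yI_y)&(D_xI_x)\otimes D_y&0 \end{pmatrix},$$ $$\mathcal E_{\text{SU-GFq}}=\alpha h\begin{pmatrix} D^x_x\otimes(D_yI_y)&(D^x_xI_x)\otimes D_y&0 \\ {D_x}\otimes(D^y_yI_y)&(D_xI_x)\otimes D^y_y&0 \\ 0&0&D^x_x\otimes M_y+M_x\otimes D^y_y \end{pmatrix}.$$ *)

(* Defs.v *)
From HB Require Import structures.
From mathcomp Require Import all_boot all_order all_algebra.
From mathcomp Require Import all_classical all_reals all_analysis.
Set Implicit Arguments.
Unset Strict Implicit.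
Unset Printing Implicit Defensive.
Import Order.TTheory GRing.Theory Num.Theory.
Import numFieldNormedType.Exports.
Local Open Scope ring_scope.

(* Legendre polynomial of degree K transported to [0, 1] (Rodrigues' formula). *)
Definition legendre01 (R : realType) (K : nat) : {poly R} :=
  (K`!%:R)^-1 *: (('X ^+ 2 - 'X) ^+ K)^`(K).

Definition gauss_lobatto (R : realType) (K : nat) (xi : 'I_K.+1 -> R) : Prop :=
  [/\ xi ord0 = 0,
      xi ord_max = 1,
      forall s r : 'I_K.+1, (s < r)%N -> xi s < xi r
    & forall s : 'I_K.+1, s != ord0 -> s != ord_max ->
        root (legendre01 R K)^`() (xi s)].

Definition ell (R : realType) (K : nat) (xi : 'I_K.+1 -> R) (s : 'I_K.+1) :
    {poly R} :=
  \prod_(r < K.+1 | r != s) ((xi s - xi r)^-1 *: ('X - (xi r)%:P)).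

(* Quadrature weights on [0, 1]: the rule is the interpolatory one. *)
Definition gl_weight (R : realType) (K : nat) (xi : 'I_K.+1 -> R)
    (s : 'I_K.+1) : R :=
  \int[lebesgue_measure]_(t in `[0, 1]%classic) (ell xi s).[t].

(* Uniform mesh with cells [origin + i step, origin + (i+1) step], i < ncell. *)
Record mesh (R : realType) := Mesh { ncell : nat; origin : R; step : R }.

Section OneDimension.
Variables (R : realType) (K : nat) (xi : 'I_K.+1 -> R) (m : mesh R).

Local Notation N := (ncell m).
Local Notation idx := 'I_(N * K).+1.

Definition vertex (i : nat) : R := origin m + i%:R * step m.

Definition lnode (i : nat) (s : 'I_K.+1) : R := vertex i + xi s * step m.

(* The global number i K + s of a local node. *)
Definition gidx (i : 'I_N) (s : 'I_K.+1) : idx := inord (i * K + s).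

(* For a = N K this is lnode N 0, the right end of the mesh. *)
Definition gnode (a : idx) : R := lnode (a %/ K) (inord (a %% K)).

(* The polynomial with which phi_a coincides on cell i; it is zero if node a
   does not lie in that cell. *)
Definition phi_cell (i : 'I_N) (a : idx) : {poly R} :=
  \sum_(s < K.+1 | gidx i s == a)
    (ell xi s \Po ((step m)^-1 *: ('X - (vertex i)%:P))).

(* At a vertex shared by two cells both polynomials take the same value, so the
   choice made by pick is immaterial. *)
Definition phi (a : idx) (x : R) : R :=
  if [pick i : 'I_N | vertex i <= x <= vertex i.+1] is Some i
  then (phi_cell i a).[x] else 0.

Definition interp (w : idx -> R) (x : R) : R :=
  \sum_(a < (N * K).+1) w a * phi a x.

(* Composite Gauss-Lobatto quadrature of a piecewise polynomial, possibly
   discontinuous at the vertices: F i is the integrand on cell i. *)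
Definition gl_quad (F : 'I_N -> {poly R}) : R :=
  \sum_(i < N) step m * \sum_(s < K.+1) gl_weight xi s * (F i).[lnode i s].

Definition mass_mx : 'M[R]_((N * K).+1) :=
  \matrix_(a, b) gl_quad (fun i => phi_cell i a * phi_cell i b).

Definition D_mx : 'M[R]_((N * K).+1) :=
  \matrix_(a, b) gl_quad (fun i => phi_cell i a * (phi_cell i b)^`()).

Definition DD_mx : 'M[R]_((N * K).+1) :=
  \matrix_(a, b) gl_quad (fun i => (phi_cell i a)^`() * (phi_cell i b)^`()).

Definition integ (w : idx -> R) (a : idx) : R :=
  \int[lebesgue_measure]_(x in `[gnode ord0, gnode a]%classic) interp w x.

(* The matrix of the linear map integ. *)
Definition I_mx : 'M[R]_((N * K).+1) :=
  \matrix_(a, b) integ (fun c => (c == b)%:R) a.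

End OneDimension.

Definition tens (R : realType) (m n : nat) (A : 'M[R]_m) (B : 'M[R]_n)
    (q : 'M[R]_(m, n)) : 'M[R]_(m, n) :=
  \matrix_(a, b) \sum_(a' < m) \sum_(b' < n) A a a' * B b b' * q a' b'.

(* Action of a 3 x 3 block operator, given by rows, on q = (u, v, p). *)
Definition block3 (V : zmodType) (A11 A12 A13 A21 A22 A23 A31 A32 A33 : V -> V)
    (q : V * V * V) : V * V * V :=
  let: (u, v, p) := q in
  (A11 u + A12 v + A13 p, A21 u + A22 v + A23 p, A31 u + A32 v + A33 p).

Section TwoDimensions.
Variables (R : realType) (K : nat) (xi : 'I_K.+1 -> R) (X Y : mesh R).

Definition gridfun := 'M[R]_((ncell X * K).+1, (ncell Y * K).+1).

Definition state := (gridfun * gridfun * gridfun)%type.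

Definition interp2 (w : gridfun) (x y : R) : R :=
  \sum_a \sum_b w a b * phi xi a x * phi xi b y.

Local Notation Mx := (mass_mx xi X).
Local Notation My := (mass_mx xi Y).
Local Notation Dx := (D_mx xi X).
Local Notation Dy := (D_mx xi Y).
Local Notation Dxx := (DD_mx xi X).
Local Notation Dyy := (DD_mx xi Y).
Local Notation Ix := (I_mx xi X).
Local Notation Iy := (I_mx xi Y).
Local Notation Z := (fun _ : gridfun => 0 : gridfun).

Definition E_CGFq : state -> state :=
  block3
    Z                      Z                      (tens Dx My)
    Z                      Z                      (tens Mx Dy)
    (tens Dx (Dy *m Iy))   (tens (Dx *m Ix) Dy)   Z.

Definition E_SUGFq (alpha : R) (q : state) : state :=
  (alpha * Num.min (step X) (step Y)) *:
  block3
    (tens Dxx (Dy *m Iy))  (tens (Dxx *m Ix) Dy)  Z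
    (tens Dx (Dyy *m Iy))  (tens (Dx *m Ix) Dyy)  Z
    Z                      Z                      (tens Dxx My \+ tens Mx Dyy)
    q.

Definition U_of (u : gridfun) : gridfun := tens 1%:M Iy u.

Definition V_of (v : gridfun) : gridfun := tens Ix 1%:M v.

Definition Phi (u v : gridfun) (i : 'I_(ncell X)) (j : 'I_(ncell Y))
    (s r : 'I_K.+1) : R :=
  \int[lebesgue_measure]_(y in `[lnode xi Y j ord0, lnode xi Y j r]%classic)
     (interp2 u (lnode xi X i s) y - interp2 u (lnode xi X i ord0) y) +
  \int[lebesgue_measure]_(x in `[lnode xi X i ord0, lnode xi X i s]%classic)
     (interp2 v x (lnode xi Y j r) - interp2 v x (lnode xi Y j ord0)).

End TwoDimensions.

(* Main.v *)
Require Import Defs.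
From mathcomp Require Import all_boot all_order all_algebra.
From mathcomp Require Import all_classical all_reals all_analysis.
From mathcomp Require Import ring.
Import Order.TTheory GRing.Theory Num.Theory.
Local Open Scope ring_scope.

(** In each block row the operators acting on [u] and [v] are
    [tens A (B *m I_y)] and [tens (A *m I_x) B], with the same [A] and [B].  Since
    [tens A B q = A q B^T] ([tensE]), the row factors through [W = U + V]: it gives
    [A W B^T], with [(A, B)] one of [(D, D)], [(DD, D)], [(D, DD)].  The basis
    functions sum to 1 on each cell, so their derivatives sum to 0; hence all row
    sums of [D] and [DD] vanish ([D_mx_row_sum], [DD_mx_row_sum]), and a matrix
    [f a + g b] is killed: the [f] part by [B] on the right, the [g] part by [A]
    on the left ([tens_separated0]).  Every block acting on the pressure has a
    factor [D] or [DD] as well, so it kills constants.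

    For the equivalence, [U] and [V] are the nodal values of primitives of
    [u_h] and [v_h] along grid lines, so that [Phi] on a cell is a mixed second
    difference of [W] based at the lower left corner of the cell ([PhiE]).  It
    vanishes when [W] is separated.  Conversely, neighbouring cells share their
    vertices, so a function that is constant on the nodes of each cell is constant
    on the grid ([gidx_constant]); applying this in [x] and then in [y] propagates
    the vanishing of the local differences to
    [W a b - W 0 b - W a 0 + W 0 0 = 0], which is a separation of [W].

    The remaining work is to justify [PhiE] from the definition of the basis
    functions: [phi] agrees on each closed cell with the polynomial of that cell
    ([phi_on_cell]), whence its nodal values, its integrability over the mesh and
    the additivity of the integrals. *)

Set Implicit Arguments.
Unset Strict Implicit.
Unset Printing Implicit Defensive.

(** * Matrices with vanishing row sums *)

Lemma mulmx_row_sums0 (R : nzRingType) m n k (A : 'M[R]_(m, n)) (g : 'I_k -> R) :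
  (forall a, \sum_b A a b = 0) -> A *m (\matrix_(_, b) g b) = 0.
Proof.
move=> A1; apply/matrixP => a b; rewrite !mxE.
under eq_bigr do rewrite mxE.
by rewrite -mulr_suml A1 mul0r.
Qed.

Lemma mulmx_tr_row_sums0 (R : comNzRingType) m n k (B : 'M[R]_(m, n))
    (f : 'I_k -> R) :
  (forall a, \sum_b B a b = 0) -> (\matrix_(a, _) f a) *m B^T = 0.
Proof.
move=> B1; apply: trmx_inj; rewrite trmx_mul trmxK trmx0.
rewrite -(mulmx_row_sums0 f B1); congr (_ *m _).
by apply/matrixP => a b; rewrite !mxE.
Qed.

(** Turns tensor products of operators into two-sided matrix products, so that
    the factorization through [U + V] is associativity. *)
Lemma tensE (R : realType) m n (A : 'M[R]_m) (B : 'M[R]_n) (q : 'M[R]_(m, n)) :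
  tens A B q = A *m q *m B^T.
Proof.
apply/matrixP => a b; rewrite !mxE exchange_big /=; apply: eq_bigr => b' _.
rewrite !mxE mulr_suml; apply: eq_bigr => a' _.
by rewrite mulrAC.
Qed.

(** * Lagrange basis at the reference nodes *)

Section ReferenceNodes.
Variables (R : realType) (K : nat) (xi : 'I_K.+1 -> R).
Hypothesis xi_gl : gauss_lobatto xi.

Lemma gl_inj : injective xi.
Proof.
have [_ _ xi_lt _] := xi_gl => s r e.
by case: (ltngtP s r) => [/xi_lt|/xi_lt|/val_inj //]; rewrite e ltxx.
Qed.

Lemma gl_bounds s : 0 <= xi s <= 1.
Proof.
have [xi0 xi1 xi_lt _] := xi_gl; apply/andP; split.
  have [->|s0] := eqVneq s ord0; first by rewrite xi0.
  by rewrite -xi0 ltW // xi_lt // lt0n.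
have [->|sK] := eqVneq s ord_max; first by rewrite xi1.
rewrite -xi1 ltW // xi_lt // ltn_neqAle -ltnS ltn_ord andbT.
exact: sK.
Qed.

Lemma ell_node s r : (ell xi s).[xi r] = (s == r)%:R.
Proof.
rewrite /ell horner_prod; have [->|sr] := eqVneq s r.
  apply: big1 => t tr; rewrite !hornerE mulVf // subr_eq0.
  by apply: contraNneq tr => /gl_inj ->.
by rewrite (bigD1 r) 1?eq_sym //= !hornerE subrr mulr0 mul0r.
Qed.

Lemma size_ell s : (size (ell xi s) <= K.+1)%N.
Proof.
apply: leq_trans (size_poly_prod_leq _ _) _.
have -> : #|[pred r : 'I_K.+1 | r != s]| = K.
  by rewrite cardC1 card_ord.
rewrite leq_subLR addnS ltnS addnn -mul2n.
apply: (@leq_trans (\sum_(r < K.+1 | r != s) 2)); last first.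
  by rewrite sum_nat_const cardC1 card_ord mulnC.
apply: leq_sum => r _.
by apply: leq_trans (size_scale_leq _ _) _; rewrite size_XsubC.
Qed.

(** The difference of the two sides has degree at most [K] and vanishes at the
    [K + 1] distinct nodes. *)
Lemma sum_ell : \sum_s ell xi s = 1.
Proof.
apply/eqP; rewrite -subr_eq0; apply/eqP.
apply: (@roots_geq_poly_eq0 _ _ [seq xi s | s <- enum 'I_K.+1]).
- apply/allP => _ /mapP[r _ ->]; rewrite rootE hornerD hornerN hornerC.
  rewrite horner_sum (bigD1 r) //= ell_node eqxx big1 ?addr0 ?subrr // => s sr.
  by rewrite ell_node (negPf sr).
- by rewrite map_inj_uniq ?enum_uniq //; exact: gl_inj.
rewrite size_map size_enum_ord.
apply: leq_trans (size_polyD _ _) _.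
rewrite size_polyN size_poly1 geq_max andbT.
by apply: leq_trans (size_sum _ _ _) _; apply/bigmax_leqP => s _; exact: size_ell.
Qed.

End ReferenceNodes.

(** * Row sums of the differentiation matrices *)

Section RowSumsOfDifferentiation.
Variables (R : realType) (K : nat) (xi : 'I_K.+1 -> R) (m : mesh R).
Hypothesis xi_gl : gauss_lobatto xi.

Lemma sum_phi_cell (i : 'I_(ncell m)) : \sum_a phi_cell xi i a = 1.
Proof.
transitivity ((\sum_s ell xi s) \Po ((step m)^-1 *: ('X - (vertex m i)%:P))).
  by rewrite raddf_sum [RHS](partition_big (gidx i) xpredT).
by rewrite sum_ell // comp_polyC.
Qed.

(** By linearity of the quadrature the sum moves onto the differentiated factor,
    where it gives the derivative of the constant 1. *)
Lemma sum_gl_quad_deriv (F : 'I_(ncell m) -> {poly R}) :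
  \sum_b gl_quad xi (fun i => F i * (phi_cell xi i b)^`()) = 0.
Proof.
rewrite /gl_quad exchange_big big1 //= => i _.
rewrite -mulr_sumr exchange_big big1 ?mulr0 //= => s _.
rewrite -mulr_sumr -horner_sum -mulr_sumr -raddf_sum /= sum_phi_cell.
by rewrite derivC mulr0 horner0 mulr0.
Qed.

Lemma D_mx_row_sum a : \sum_b D_mx xi m a b = 0.
Proof. by under eq_bigr do rewrite mxE; exact: sum_gl_quad_deriv. Qed.

Lemma DD_mx_row_sum a : \sum_b DD_mx xi m a b = 0.
Proof. by under eq_bigr do rewrite mxE; exact: sum_gl_quad_deriv. Qed.

End RowSumsOfDifferentiation.

(** * Nodes and basis functions *)

Section Nodes.
Variables (R : realType) (K : nat) (xi : 'I_K.+1 -> R) (m : mesh R).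
Hypotheses (K_gt0 : (0 < K)%N) (xi_gl : gauss_lobatto xi).
Hypothesis step_gt0 : 0 < step m.

Lemma val_gidx (i : 'I_(ncell m)) (s : 'I_K.+1) : gidx i s = (i * K + s)%N :> nat.
Proof.
rewrite /gidx inordK // ltnS (@leq_trans (i.+1 * K)) ?leq_mul2r ?ltn_ord ?orbT //.
by rewrite mulSn addnC leq_add2r -ltnS ltn_ord.
Qed.

Lemma gidx_surj (N_gt0 : (0 < ncell m)%N) (a : 'I_(ncell m * K).+1) :
  exists i s, a = gidx i s.
Proof.
have [aN|aN] := ltnP a (ncell m * K).
  have iN : (a %/ K < ncell m)%N by rewrite ltn_divLR.
  exists (Ordinal iN), (inord (a %% K)); apply: ord_inj.
  by rewrite val_gidx /= inordK ?[LHS](divn_eq a K) // ltnW // ltnS ltn_pmod.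
have iN : ((ncell m).-1 < ncell m)%N by rewrite prednK.
(* The right end of the mesh is the last node of the last cell. *)
exists (Ordinal iN), ord_max; apply: ord_inj; rewrite val_gidx /=.
by rewrite addnC -mulSn prednK //; apply/eqP; rewrite eqn_leq aN -ltnS ltn_ord.
Qed.

Lemma gidx_shared (i j : 'I_(ncell m)) :
  j = i.+1 :> nat -> gidx i (@ord_max K) = gidx j ord0.
Proof. by move=> ji; apply: ord_inj; rewrite !val_gidx ji addn0 mulSn addnC. Qed.

Lemma lnode0 i : lnode xi m i ord0 = vertex m i.
Proof. by have [xi0 _ _ _] := xi_gl; rewrite /lnode xi0 mul0r addr0. Qed.

Lemma lnodeK i : lnode xi m i ord_max = vertex m i.+1.
Proof.
have [_ xi1 _ _] := xi_gl.
by rewrite /lnode xi1 /vertex -addrA -mulrDl natr1.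
Qed.

(** For [s = K] the division of [i K + s] by [K] selects the first node of the
    following cell, which is the same point. *)
Lemma gnode_gidx (i : 'I_(ncell m)) s : gnode xi (gidx i s) = lnode xi m i s.
Proof.
rewrite /gnode val_gidx; have [->|sK] := eqVneq s ord_max.
  rewrite lnodeK /= addnC -mulSn mulnK // modnMl -lnode0; congr lnode.
  by apply: ord_inj; rewrite inordK.
have {}sK : (s < K)%N by rewrite ltn_neqAle -ltnS ltn_ord andbT; exact: sK.
rewrite divnMDl // divn_small // addn0 modnMDl modn_small //.
by rewrite inord_val.
Qed.

Lemma vertex_le i j : (i <= j)%N -> vertex m i <= vertex m j.
Proof. by move=> ij; rewrite lerD2l ler_pM2r // ler_nat. Qed.

Lemma vertex_lt i j : (i < j)%N -> vertex m i < vertex m j.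
Proof. by move=> ij; rewrite ltrD2l ltr_pM2r // ltr_nat. Qed.

Lemma lnode_bounds i s : vertex m i <= lnode xi m i s <= vertex m i.+1.
Proof.
have /andP[s0 s1] := gl_bounds xi_gl s.
rewrite -lnodeK /lnode; have [_ -> _ _] := xi_gl.
by rewrite lerDl mulr_ge0 ?(ltW step_gt0) //= lerD2l ler_pM2r.
Qed.

Lemma phi_cell_node (i : 'I_(ncell m)) a s :
  (phi_cell xi i a).[lnode xi m i s] = (gidx i s == a)%:R.
Proof.
have ref r : (ell xi r \Po ((step m)^-1 *: ('X - (vertex m i)%:P))).[lnode xi m i s]
    = (r == s)%:R.
  rewrite horner_comp !hornerE /lnode [_ + _ - _]addrC addKr mulrC.
  by rewrite mulfK ?ell_node // (gt_eqF step_gt0).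
rewrite /phi_cell horner_sum big_mkcond (bigD1 s) //= big1 ?addr0 => [|r rs].
  by rewrite ref eqxx; case: eqP.
by rewrite ref (negPf rs) if_same.
Qed.

(** Two cells with a common point are adjacent and meet at a vertex, which is the
    last node of one and the first node of the other, under one global number. *)
Lemma phi_cell_agree (i j : 'I_(ncell m)) a x :
  vertex m i <= x <= vertex m i.+1 -> vertex m j <= x <= vertex m j.+1 ->
  (i < j)%N -> (phi_cell xi i a).[x] = (phi_cell xi j a).[x].
Proof.
move=> /andP[_ xi1] /andP[jx _] ij.
have ji : j = i.+1 :> nat.
  apply/eqP; rewrite eqn_leq ij andbT leqNgt; apply/negP => /vertex_lt.
  by rewrite ltNge (le_trans jx xi1).
have -> : x = vertex m i.+1 by apply/eqP; rewrite eq_le xi1 -ji.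
by rewrite -{1}lnodeK -ji -lnode0 !phi_cell_node (gidx_shared ji).
Qed.

(** Whatever cell the choice in [phi] picks for a vertex, the value is the same:
    this is the continuity of the basis functions. *)
Lemma phi_on_cell (i : 'I_(ncell m)) a x :
  vertex m i <= x <= vertex m i.+1 -> phi xi a x = (phi_cell xi i a).[x].
Proof.
move=> ix; rewrite /phi; case: pickP => [j jx|/(_ i)]; last by rewrite ix.
have [ij|ji|/val_inj -> //] := ltngtP i j.
  by rewrite (phi_cell_agree a ix jx).
by rewrite (phi_cell_agree a jx ix).
Qed.

Lemma phi_node (i : 'I_(ncell m)) a s :
  phi xi a (lnode xi m i s) = (gidx i s == a)%:R.
Proof. by rewrite (phi_on_cell a (lnode_bounds _ _)) // phi_cell_node. Qed.

(** Constancy propagates from cell to cell through the shared vertices. *)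
Lemma gidx_constant (V : Type) (G : 'I_(ncell m * K).+1 -> V) :
  (0 < ncell m)%N ->
  (forall i s, G (gidx i s) = G (gidx i ord0)) -> forall a, G a = G ord0.
Proof.
move=> N_gt0 Gc a; have [i [s ->]] := gidx_surj N_gt0 a; rewrite Gc {s a}.
case: i; elim=> [|i IHi] iN.
  by congr G; apply: ord_inj; rewrite val_gidx /= mul0n.
rewrite -(IHi (ltnW iN)) -[RHS](Gc _ ord_max); congr G.
exact/esym/gidx_shared.
Qed.

End Nodes.

(** * Integrals of the interpolants *)

Section IntegrationOnUnions.
Context d (T : measurableType d) (R : realType) (mu : {measure set T -> \bar R}).

Lemma integrable_setU (A B : set T) (f : T -> \bar R) :
  measurable A -> measurable B ->
  mu.-integrable A f -> mu.-integrable B f -> mu.-integrable (A `|` B) f.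
Proof.
move=> mA mB iA iB; have mAB := measurableU _ _ mA mB.
have mBA : measurable (B `\` A) by exact: measurableD.
have {}iB : mu.-integrable (B `\` A) f.
  by apply: integrableS iB => // x [].
apply/(integrable_mkcond _ mAB).
move/(integrable_mkcond _ mA): iA => iA; move/(integrable_mkcond _ mBA): iB => iB.
apply: eq_integrable (integrableD measurableT iA iB) => // x _ /=.
rewrite !patchE in_setU in_setD.
by case: (x \in A); rewrite ?andbF ?adde0 ?add0e ?andbT.
Qed.

Lemma Rintegral_sum (D : set T) I (s : seq I) (f : I -> T -> R) :
  measurable D -> (forall i, mu.-integrable D (EFin \o f i)) ->
  \int[mu]_(x in D) (\sum_(i <- s) f i x) =
  \sum_(i <- s) \int[mu]_(x in D) f i x.
Proof.
move=> mD fi; rewrite /Rintegral sum_fine => [|i _]; last first.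
  exact: (integrable_fin_num mD (fi i)).
rewrite -integral_sum //; congr fine; apply: eq_integral => x _.
by rewrite sumEFin.
Qed.

End IntegrationOnUnions.

Section Integration.
Variables (R : realType) (K : nat) (xi : 'I_K.+1 -> R) (m : mesh R).
Hypotheses (K_gt0 : (0 < K)%N) (xi_gl : gauss_lobatto xi).
Hypothesis step_gt0 : 0 < step m.
Local Notation mu := (@lebesgue_measure R).
Local Open Scope classical_set_scope.

(** Over each closed cell the integrand is a polynomial, and the mesh is a finite
    union of cells. *)
Lemma integrable_phi (a : 'I_(ncell m * K).+1) :
  mu.-integrable `[vertex m 0, vertex m (ncell m)] (EFin \o phi xi a).
Proof.
have cell (i : 'I_(ncell m)) :
    mu.-integrable `[vertex m i, vertex m i.+1] (EFin \o phi xi a).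
  have : mu.-integrable `[vertex m i, vertex m i.+1]
      (EFin \o horner (phi_cell xi i a)).
    apply: continuous_compact_integrable; first exact: segment_compact.
    by apply: continuous_subspaceT; exact: continuous_horner.
  apply: eq_integrable => // x; rewrite inE /= in_itv /= => ix.
  by rewrite (phi_on_cell xi_gl step_gt0 a ix).
suff : forall k, (k <= ncell m)%N ->
    mu.-integrable `[vertex m 0, vertex m k] (EFin \o phi xi a) by apply.
elim=> [_|k IHk kN].
  rewrite set_itv1; apply: null_set_integrable; first exact: measurable_set1.
    exact: measurable_fun_set1.
  exact: lebesgue_measure_set1.
rewrite (_ : `[_, _] = `[vertex m 0, vertex m k] `|` `[vertex m k, vertex m k.+1]).
  apply: integrable_setU => //; first exact: IHk (ltnW kN).
  exact: (cell (Ordinal kN)).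
apply/seteqP; split=> x /=; rewrite !in_itv /=.
  by move=> /andP[x0 x1]; case: (leP x (vertex m k)) => xk; [left|right];
    rewrite ?x0 ?x1 ?(ltW xk).
case=> /andP[x0 x1]; rewrite ?x0 ?x1 ?andbT /=.
  by apply: le_trans x1 _; exact: vertex_le.
by apply: le_trans x0; exact: vertex_le.
Qed.

Lemma integrable_interp (w : 'I_(ncell m * K).+1 -> R) :
  mu.-integrable `[vertex m 0, vertex m (ncell m)] (EFin \o interp xi w).
Proof.
have : mu.-integrable `[vertex m 0, vertex m (ncell m)]
    (fun x => \sum_a (w a * phi xi a x)%:E)%E.
  apply: integrable_sum => // a _.
  by apply: eq_integrable (integrableZl _ (w a) (integrable_phi a)).
by apply: eq_integrable => // x _; rewrite /= /interp sumEFin.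
Qed.

Lemma lnode_mesh (i : 'I_(ncell m)) s :
  vertex m 0 <= lnode xi m i s <= vertex m (ncell m).
Proof.
have /andP[x0 x1] := lnode_bounds xi_gl step_gt0 i s.
by rewrite (le_trans (vertex_le _ _) x0) // (le_trans x1) // vertex_le.
Qed.

Lemma integrable_node (f : R -> R) (i : 'I_(ncell m)) s :
  mu.-integrable `[vertex m 0, vertex m (ncell m)] (EFin \o f) ->
  mu.-integrable `[vertex m 0, lnode xi m i s] (EFin \o f).
Proof.
apply: integrableS => // x /=; rewrite !in_itv /=.
move=> /andP[-> xs] /=; apply: le_trans xs _.
by have /andP[] := lnode_mesh i s.
Qed.

Lemma integrable_interp_cell (w : 'I_(ncell m * K).+1 -> R) (i : 'I_(ncell m)) s :
  mu.-integrable `[lnode xi m i ord0, lnode xi m i s] (EFin \o interp xi w).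
Proof.
apply: integrableS (integrable_node i s (integrable_interp w)) => // x /=.
rewrite !in_itv /=.
move=> /andP[xs ->]; rewrite andbT; apply: le_trans xs.
by have /andP[] := lnode_mesh i ord0.
Qed.

Lemma integ_gidx (w : 'I_(ncell m * K).+1 -> R) (i : 'I_(ncell m)) s :
  integ xi w (gidx i s) =
  \int[mu]_(x in `[vertex m 0, lnode xi m i s]) interp xi w x.
Proof.
have i0 : (0 < ncell m)%N := leq_ltn_trans (leq0n i) (ltn_ord i).
have o0 : ord0 = gidx (Ordinal i0) (@ord0 K).
  by apply: ord_inj; rewrite val_gidx /= mul0n.
by rewrite /integ !gnode_gidx // o0 gnode_gidx // lnode0.
Qed.

Lemma integ_gidxB (w : 'I_(ncell m * K).+1 -> R) (i : 'I_(ncell m)) s :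
  integ xi w (gidx i s) - integ xi w (gidx i ord0) =
  \int[mu]_(x in `[lnode xi m i ord0, lnode xi m i s]) interp xi w x.
Proof.
have /andP[x0 _] := lnode_mesh i ord0.
have xs : lnode xi m i ord0 <= lnode xi m i s.
  by rewrite lnode0 //; have /andP[] := lnode_bounds xi_gl step_gt0 i s.
rewrite !integ_gidx Rintegral_itvB ?bnd_simp //; last first.
  exact/integrable_node/integrable_interp.
apply: Rintegral_itv_obnd_cbnd.
apply: integrableS (integrable_interp_cell w i s) => //.
exact: subset_itv_oc_cc.
Qed.

(** The columns of [I_mx] are the integrals of the basis functions, so this is
    linearity of the integral. *)
Lemma integE (w : 'I_(ncell m * K).+1 -> R) (a : 'I_(ncell m * K).+1) :
  (0 < ncell m)%N -> integ xi w a = \sum_b I_mx xi m a b * w b.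
Proof.
move=> N_gt0; have [i [s ->]] := gidx_surj K_gt0 N_gt0 a.
have interp_basis b x : interp xi (fun c => (c == b)%:R) x = phi xi b x.
  rewrite /interp (bigD1 b) //= eqxx mul1r big1 ?addr0 // => c /negPf ->.
  by rewrite mul0r.
rewrite integ_gidx /interp.
rewrite Rintegral_sum // => [|b]; last first.
  have iphi := integrable_node i s (integrable_phi b).
  by apply: eq_integrable (integrableZl _ (w b) iphi).
apply: eq_bigr => b _; rewrite RintegralZl //; last first.
  exact/integrable_node/integrable_phi.
rewrite mxE integ_gidx mulrC.
by under [in RHS]eq_Rintegral do rewrite interp_basis.
Qed.

End Integration.

(** * The two-dimensional scheme *)

Section TwoDimensions.
Variables (R : realType) (K : nat) (xi : 'I_K.+1 -> R) (X Y : mesh R).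
Hypotheses (K_gt0 : (0 < K)%N) (xi_gl : gauss_lobatto xi).
Hypotheses (Nx_gt0 : (0 < ncell X)%N) (Ny_gt0 : (0 < ncell Y)%N).
Hypotheses (dx_gt0 : 0 < step X) (dy_gt0 : 0 < step Y).
Variables (u v : gridfun K X Y).

Local Notation W a b := (U_of xi u a b + V_of xi v a b).

Lemma U_ofE a b : U_of xi u a b = integ xi (u a) b.
Proof.
rewrite /U_of tensE mul1mx mxE integE //.
by apply: eq_bigr => c _; rewrite [X in _ * X]mxE mulrC.
Qed.

Lemma V_ofE a b : V_of xi v a b = integ xi (v^~ b) a.
Proof. by rewrite /V_of tensE trmx1 mulmx1 mxE integE. Qed.

Lemma interp2_nodel (w : gridfun K X Y) (i : 'I_(ncell X)) s y :
  interp2 xi w (lnode xi X i s) y = interp xi (w (gidx i s)) y.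
Proof.
rewrite /interp2 (bigD1 (gidx i s)) //= [X in _ + X]big1 ?addr0.
  by apply: eq_bigr => b _; rewrite phi_node // eqxx mulr1.
move=> a /negPf ai; apply: big1 => b _.
by rewrite phi_node // eq_sym ai mulr0 mul0r.
Qed.

Lemma interp2_noder (w : gridfun K X Y) (j : 'I_(ncell Y)) r x :
  interp2 xi w x (lnode xi Y j r) = interp xi (w^~ (gidx j r)) x.
Proof.
apply: eq_bigr => a _; rewrite (bigD1 (gidx j r)) //= [X in _ + X]big1 ?addr0.
  by rewrite phi_node // eqxx mulr1.
by move=> b /negPf bj; rewrite phi_node // eq_sym bj mulr0.
Qed.

(** At a node of the first variable the two-dimensional interpolant reduces to the
    interpolant of a row (or column) of the grid function, and the integral of the
    latter over part of a cell is a difference of nodal values of [U] (or [V]). *)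
Lemma PhiE (i : 'I_(ncell X)) (j : 'I_(ncell Y)) s r :
  Phi xi u v i j s r =
  W (gidx i s) (gidx j r) - W (gidx i s) (gidx j ord0)
    - (W (gidx i ord0) (gidx j r) - W (gidx i ord0) (gidx j ord0)).
Proof.
rewrite /Phi !U_ofE !V_ofE.
under eq_Rintegral do rewrite !interp2_nodel.
under [X in _ + X]eq_Rintegral do rewrite !interp2_noder.
rewrite !RintegralB //; try exact: integrable_interp_cell.
rewrite -!integ_gidxB //.
ring.
Qed.

Lemma separated_PhiP :
  (exists (f : 'I_(ncell X * K).+1 -> R) (g : 'I_(ncell Y * K).+1 -> R),
     forall a b, W a b = f a + g b) <->
  (forall i j s r, Phi xi u v i j s r = 0).
Proof.
split=> [[f [g fg]] i j s r|Phi0]; first by rewrite PhiE !fg; ring.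
(* [G a b] is what is left of [W a b] after removing the profile on the left
   edge of the domain; it remains to see that it depends on [a] only. *)
pose G a b := W a b - W ord0 b.
have G_const a b : G a b = G a ord0.
  apply: (gidx_constant K_gt0 Ny_gt0) => j r.
  suff /(_ a) : forall a, W a (gidx j r) - W a (gidx j ord0) =
      W ord0 (gidx j r) - W ord0 (gidx j ord0).
    by rewrite /G => /eqP; rewrite subr_eq => /eqP ->; ring.
  apply: (gidx_constant K_gt0 Nx_gt0
    (G := fun a => W a (gidx j r) - W a (gidx j ord0))) => i s.
  by apply/eqP; rewrite -subr_eq0 -PhiE Phi0.
exists (G^~ ord0), (fun b => W ord0 b) => a b.
by rewrite -(G_const a b) subrK.
Qed.

(** The block row factors as [A (U + V) B^T]. *)
Lemma tens_separated0 (A : 'M[R]_((ncell X * K).+1))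
    (B : 'M[R]_((ncell Y * K).+1)) f g :
  (forall a, \sum_b A a b = 0) -> (forall a, \sum_b B a b = 0) ->
  (forall a b, W a b = f a + g b) ->
  tens A (B *m I_mx xi Y) u + tens (A *m I_mx xi X) B v = 0.
Proof.
move=> A0 B0 fg.
have -> : tens A (B *m I_mx xi Y) u + tens (A *m I_mx xi X) B v =
    A *m (U_of xi u + V_of xi v) *m B^T.
  by rewrite /U_of /V_of !tensE mul1mx trmx1 mulmx1 trmx_mul mulmxDr mulmxDl !mulmxA.
have -> : U_of xi u + V_of xi v = (\matrix_(a, _) f a) + (\matrix_(_, b) g b).
  by apply/matrixP => a b; rewrite !mxE -fg !mxE.
rewrite mulmxDr mulmxDl (mulmx_row_sums0 g A0) mul0mx addr0.
by rewrite -mulmxA mulmx_tr_row_sums0 // mulmx0.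
Qed.

Lemma tens_const_row_suml0 (A : 'M[R]_((ncell X * K).+1))
    (B : 'M[R]_((ncell Y * K).+1)) (p : gridfun K X Y) c :
  (forall a b, p a b = c) -> (forall a, \sum_b A a b = 0) -> tens A B p = 0.
Proof.
move=> pc A0; rewrite tensE.
have -> : p = \matrix_(_, b) c by apply/matrixP => a b; rewrite pc mxE.
by rewrite (mulmx_row_sums0 (fun=> c) A0) mul0mx.
Qed.

Lemma tens_const_row_sumr0 (A : 'M[R]_((ncell X * K).+1))
    (B : 'M[R]_((ncell Y * K).+1)) (p : gridfun K X Y) c :
  (forall a b, p a b = c) -> (forall a, \sum_b B a b = 0) -> tens A B p = 0.
Proof.
move=> pc B0; rewrite tensE -mulmxA.
have -> : p = \matrix_(a, _) c by apply/matrixP => a b; rewrite pc mxE.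
by rewrite (mulmx_tr_row_sums0 (fun=> c) B0) mulmx0.
Qed.

Lemma separated_equilibrium alpha (p : gridfun K X Y) c f g :
  (forall a b, p a b = c) -> (forall a b, W a b = f a + g b) ->
  E_CGFq xi (u, v, p) + E_SUGFq xi alpha (u, v, p) = 0.
Proof.
move=> pc fg.
have Dx0 := @D_mx_row_sum _ _ _ X xi_gl; have Dy0 := @D_mx_row_sum _ _ _ Y xi_gl.
have Dxx0 := @DD_mx_row_sum _ _ _ X xi_gl.
have Dyy0 := @DD_mx_row_sum _ _ _ Y xi_gl.
rewrite /E_CGFq /E_SUGFq /block3 /= (tens_separated0 Dx0 Dy0 fg).
rewrite (tens_separated0 Dxx0 Dy0 fg) (tens_separated0 Dx0 Dyy0 fg).
rewrite !(tens_const_row_suml0 _ pc Dx0) (tens_const_row_suml0 _ pc Dxx0).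
rewrite (tens_const_row_sumr0 _ pc Dy0) (tens_const_row_sumr0 _ pc Dyy0) !addr0.
by rewrite (_ : (0, 0, 0) = 0) // scaler0 addr0.
Qed.

End TwoDimensions.

Theorem proposition5p1 (R : realType) (K : nat) (hK : (1 <= K)%N)
    (xi : 'I_K.+1 -> R) (hxi : gauss_lobatto xi)
    (X Y : mesh R)
    (hNx : (0 < ncell X)%N) (hNy : (0 < ncell Y)%N)
    (hdx : 0 < step X) (hdy : 0 < step Y)
    (alpha : R)
    (u v p : gridfun K X Y)
    (hp : exists c : R, forall a b, p a b = c) :
  let separated :=
    exists (f : 'I_(ncell X * K).+1 -> R) (g : 'I_(ncell Y * K).+1 -> R),
      forall a b, U_of xi u a b + V_of xi v a b = f a + g b in
  let Phi_vanishes :=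
    forall (i : 'I_(ncell X)) (j : 'I_(ncell Y)) (s r : 'I_K.+1),
      Phi xi u v i j s r = 0 in
  (separated <-> Phi_vanishes) /\
  (separated \/ Phi_vanishes ->
     E_CGFq xi (u, v, p) + E_SUGFq xi alpha (u, v, p) = 0).
Proof.
have W_Phi := separated_PhiP hK hxi hNx hNy hdx hdy u v.
split=> // sep; have [c pc] := hp.
have [f [g fg]] : exists f g, forall a b,
    U_of xi u a b + V_of xi v a b = f a + g b.
  by case: sep => [//|/W_Phi].
exact (separated_equilibrium hxi alpha pc fg).
Qed.
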